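(* Consider the Bayesian model with exponential prior on the error variance described in the context, with $L$ nondecreasing and $0<L(u)\le M<\infty$. Let $0<\eta<\min(a,1/2)$. Then there is a constant $C>0$, not depending on $\tau$ or $X_i$, such that for any $0<\tau<1$ and every value of $X_i\in\mathbb{R}$, $$\mathbb{E}(1-\kappa_i\mid X_i)\le C\,\tau^{2\eta}\exp(|X_i|).$$
   Context: Model (for given $\tau>0$): (i) $X_i\mid\theta_i,\sigma_i^2\sim N(\theta_i,\sigma_i^2)$ independently, $i=1,\dots,n$; (ii) $\theta_i\mid\sigma_i^2,\lambda_i^2,\tau^2\sim N(0,\sigma_i^2\lambda_i^2\tau^2)$ independently; (iii) $\lambda_1^2,\dots,\lambda_n^2,\sigma_1^2,\dots,\sigma_n^2$ are mutually independent, each $\lambda_i^2$ having the proper prior density $\Pi(\lambda_i^2)=K(\lambda_i^2)^{-a-1}L(\lambda_i^2)$ on $(0,\infty)$, with $a>0$, $K>0$ the normalizing constant, and $L$ a slowly varying function (at infinity); (iv) each $\sigma_i^2$ has prior density $\Pi(\sigma_i^2)=\tfrac12\exp(-\sigma_i^2/2)$ on $(0,\infty)$. Standing assumption on $L$: it is nondecreasing and $0<L(u)\le M<\infty$ for all $u>0$. The shrinkage factor is $\kappa_i=(1+\lambda_i^2\tau^2)^{-1}$, and $\mathbb{E}(\cdot\mid X_i)$ denotes posterior expectation given $X_i$ under this model. *)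

(* Defs.v *)
From HB Require Import structures.
From mathcomp Require Import all_boot all_order all_algebra.
From mathcomp Require Import all_classical all_reals all_analysis.
From mathcomp Require Import measurable_realfun.

Set Implicit Arguments.
Unset Strict Implicit.
Unset Printing Implicit Defensive.

Import Order.TTheory GRing.Theory Num.Theory.
Import numFieldNormedType.Exports.

Local Open Scope classical_set_scope.
Local Open Scope ring_scope.

Definition slowly_varying (R : realType) (L : R -> R) : Prop :=
  forall c : R, 0 < c -> L (c * u) / L u @[u --> +oo] --> (1 : R).

Definition lambda2_pdf (R : realType) (K a : R) (L : R -> R) (u : R) : R :=
  if 0 < u then K * u `^ (- a - 1) * L u else 0.

Definition sigma2_pdf (R : realType) (s : R) : R :=
  if 0 < s then 2^-1 * expR (- (s / 2)) else 0.

(* N(m, v) is parametrized by its variance v in the model, whereas [normal_pdf]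
   takes the standard deviation.  The value of [normal_pdf] at standard
   deviation 0 is irrelevant here: it only occurs where the prior vanishes. *)
Definition normal_var_pdf (R : realType) (m v x : R) : R :=
  normal_pdf m (Num.sqrt v) x.

Definition shrinkage (R : realType) (tau l : R) : R := (1 + l * tau ^+ 2)^-1.

(* Joint density of (X_i, theta_i, lambda_i^2, sigma_i^2): the product of the
   (conditional) densities of the levels of the hierarchy. *)
Definition joint_pdf (R : realType) (K a : R) (L : R -> R) (tau : R)
    (p : R * R * R * R) : R :=
  let: (x, t, l, s) := p in
  normal_var_pdf t s x * normal_var_pdf 0 (s * l * tau ^+ 2) t
    * lambda2_pdf K a L l * sigma2_pdf s.

Section model.
Context (R : realType) (d : measure_display) (T : measurableType d)
  (P : probability T R) (n : nat).
Variables X theta lambda2 sigma2 : 'I_n -> {RV P >-> R}.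

Local Notation mu := (@lebesgue_measure R).

Definition unit_of (i : 'I_n) (w : T) : R * R * R * R :=
  (X i w, theta i w, lambda2 i w, sigma2 i w).

(* All the independence assumptions of the hierarchy together say that the
   joint density of the 4n variables is the product over i of [joint_pdf], i.e.
   that the n quadruples are independent, each with density [joint_pdf].  The
   product rule for subfamilies is the case where some A i are [setT]. *)
Definition hierarchical_model (K a : R) (L : R -> R) (tau : R) : Prop :=
  (forall A : 'I_n -> set (R * R * R * R), (forall i, measurable (A i)) ->
     P (\bigcap_i (unit_of i @^-1` A i)) =
     (\prod_(i < n) P (unit_of i @^-1` A i))%E) /\
  (forall (i : 'I_n) (A : set (R * R * R * R)), measurable A ->
     P (unit_of i @^-1` A) =
     (\int[mu]_x \int[mu]_t \int[mu]_l \int[mu]_s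
        (joint_pdf K a L tau (x, t, l, s) * \1_A (x, t, l, s))%:E)%E).

(* Posterior expectation of h(theta_i, lambda_i^2, sigma_i^2) given X_i = x, by
   Bayes' formula: the prior expectation weighted by the likelihood
   N(theta_i, sigma_i^2) of the observation x.  Unlike an abstract conditional
   expectation, it is defined at every x and not only almost everywhere. *)
Definition posterior_expectation (i : 'I_n) (h : R -> R -> R -> R)
    (x : R) : R :=
  let lik w := normal_var_pdf (theta i w) (sigma2 i w) x in
  fine (\int[P]_w (h (theta i w) (lambda2 i w) (sigma2 i w) * lik w)%:E)
  / fine (\int[P]_w (lik w)%:E).

End model.

(* Main.v *)
(* The weights N(x; theta, s) N(theta; 0, s l tau^2) integrate over theta to
   N(x; 0, s y) with y = 1 + l tau^2, so the posterior expectation is a ratio of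
   double integrals over (l, s).  Uniformly in x, the integral of N(x; 0, s y)
   against the exponential prior of s is at most a constant (this is where
   s^(-1/2) exp(-s/2) must be integrable) and, for y <= 3, at least a constant
   times exp(-|x|): the prior and the likelihood together contribute
   exp(-(x^2/s + s)/2), and s may be restricted to a window of width sqrt |x| + 1
   to the right of |x|.  In the numerator
   1 - kappa = z / (1 + z) <= z^eta for z = l tau^2, which produces tau^(2 eta)
   and the prior moment of order eta of l, finite because eta < a.  In the
   denominator it is enough to keep 1 <= l <= 2. *)
From HB Require Import structures.
Require Import Defs.
From mathcomp Require Import all_boot all_order all_algebra.
From mathcomp Require Import all_classical all_reals all_analysis.
From mathcomp Require Import measurable_realfun.
From mathcomp Require Import ring lra.
Import Order.TTheory GRing.Theory Num.Theory.
Import numFieldNormedType.Exports.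
Local Open Scope classical_set_scope.
Local Open Scope ring_scope.

Set Implicit Arguments.
Unset Strict Implicit.
Unset Printing Implicit Defensive.

(** * Integration against a measure given by a density *)

Section density.
Local Open Scope ereal_scope.
Context d (T : measurableType d) (R : realType).
Variables (nu m : {measure set T -> \bar R}) (f : T -> R).
Hypothesis mf : measurable_fun [set: T] f.
Hypothesis f0 : forall x, (0 <= f x)%R.
Hypothesis nuE : forall A, measurable A -> nu A = \int[m]_x (f x * \1_A x)%:E.

Import HBNNSimple.

(** The standard extension argument: [nuE] is the case of indicators, linearity gives simple
    functions, and monotone convergence along [nnsfun_approx] gives all nonnegative measurable
    [g]. *)
Lemma ge0_integral_density (g : T -> \bar R) :
  measurable_fun [set: T] g -> (forall x, 0 <= g x) ->
  \int[nu]_x g x = \int[m]_x ((f x)%:E * g x).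
Proof.
move=> mg g0; pose h := nnsfun_approx measurableT mg.
have hg x : (EFin \o h n) x @[n --> \oo] --> g x.
  by apply: cvg_nnsfun_approx.
have hnd x : {homo (fun n => (h n x)%:E) : a b / (a <= b)%N >-> a <= b}.
  by move=> a b ab; rewrite lee_fin; exact/lefP/nd_nnsfun_approx.
have -> : \int[nu]_x g x = lim (\int[nu]_x (EFin \o h n) x @[n --> \oo]).
  under eq_integral => x _ do rewrite -(cvg_lim (@ereal_hausdorff R) (hg x)).
  apply: monotone_convergence => // [n|n x _|x _].
  - exact/measurable_EFinP.
  - by rewrite lee_fin.
  - exact: hnd.
have -> : \int[m]_x ((f x)%:E * g x) =
    lim (\int[m]_x ((f x)%:E * (h n x)%:E) @[n --> \oo]).
  have fgE x : (f x)%:E * g x = lim ((f x)%:E * (h n x)%:E @[n --> \oo]).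
    by apply/esym/cvg_lim => //; apply: cvgeZl => //; exact: hg.
  under eq_integral => x _ do rewrite fgE.
  apply: monotone_convergence => // [n|n x _|x _].
  - by apply: emeasurable_funM; exact/measurable_EFinP.
  - by rewrite mule_ge0 ?lee_fin.
  - by move=> a b ab; rewrite lee_wpmul2l ?lee_fin//; exact/lefP/nd_nnsfun_approx.
(* Both limits are now over simple functions. Each [h n] is expanded below as a finite sum over its
   values of multiples of indicators of level sets, where [nuE] applies. *)
suff suf n : \int[m]_x ((f x)%:E * (h n x)%:E) = \int[nu]_x (EFin \o h n) x.
  by under eq_fun do rewrite -suf.
have mind r : measurable_fun [set: T]
    (fun x => (r * \1_(h n @^-1` [set r]) x)%:E).
  by apply/measurable_EFinP; exact: measurable_funM.
transitivity (\int[m]_x (\sum_(y \in range (h n))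
    (f x)%:E * (y * \1_(h n @^-1` [set y]) x)%:E)).
  apply: eq_integral => x _; rewrite fimfunE -fsumEFin//.
  by rewrite ge0_mule_fsumr// => y; exact: nnfun_muleindic_ge0.
rewrite ge0_integral_fsum//; last 2 first.
  - by move=> y; apply: emeasurable_funM => //; exact/measurable_EFinP.
  - by move=> y x _; rewrite mule_ge0 ?lee_fin// -lee_fin nnfun_muleindic_ge0.
under [RHS]eq_integral do rewrite /= fimfunE -fsumEFin//.
rewrite ge0_integral_fsum//; last first.
  by move=> y x _; exact: nnfun_muleindic_ge0.
apply: eq_fsbigr => r /[!inE] -[x _ <-].
under [RHS]eq_integral do rewrite EFinM.
rewrite integralZl_indic_nnsfun//= integral_indic// setIT nuE//.
rewrite -ge0_integralZl//.
- by apply: eq_integral => y _; rewrite -!EFinM mulrCA.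
- by apply/measurable_EFinP; apply: measurable_funM.
- by move=> y _; rewrite lee_fin mulr_ge0.
- by rewrite lee_fin.
Qed.

End density.

(* An alias of [m1 \x m2]: the library registers the product as a sigma-finite
   measure only when both factors are subprobabilities. *)
Definition sigma_product {d1 d2} {T1 : measurableType d1} {T2 : measurableType d2}
    {R : realType} (m1 : {sigma_finite_measure set T1 -> \bar R})
    (m2 : {sigma_finite_measure set T2 -> \bar R}) : set (T1 * T2) -> \bar R :=
  (m1 \x m2)%E.

Section sigma_product.
Local Open Scope ereal_scope.
Context d1 d2 (T1 : measurableType d1) (T2 : measurableType d2) (R : realType).
Variables (m1 : {sigma_finite_measure set T1 -> \bar R})
  (m2 : {sigma_finite_measure set T2 -> \bar R}).

HB.instance Definition _ :=
  Measure.copy (sigma_product m1 m2) (m1 \x m2).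

Let sigma_product_sigma_finite : sigma_finite setT (sigma_product m1 m2).
Proof.
have /sigma_finiteP[F [FT ndF Foo]] := sigma_finiteT m1.
have /sigma_finiteP[G [GT ndG Goo]] := sigma_finiteT m2.
(* Increasing exhaustions are used so that one index, the maximum of two, captures both
   coordinates. *)
exists (fun n => F n `*` G n) => [|n].
- apply/seteqP; split=> // -[x y] _.
  have [i _ Fix] : (\bigcup_i F i) x by rewrite -FT.
  have [j _ Gjy] : (\bigcup_j G j) y by rewrite -GT.
  exists (maxn i j) => //; split => /=.
  + by move: Fix; apply/subsetPset/ndF/leq_maxl.
  + by move: Gjy; apply/subsetPset/ndG/leq_maxr.
- have [mFn Fnoo] := Foo n; have [mGn Gnoo] := Goo n.
  split; first exact: measurableX.
  by rewrite /sigma_product product_measure1E// lte_mul_pinfty// ge0_fin_numE.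
Qed.

HB.instance Definition _ := Measure_isSigmaFinite.Build _ _ _
  (sigma_product m1 m2) sigma_product_sigma_finite.

End sigma_product.

(** * Four-fold iterated integrals as integrals over the product *)

Section iterated.
Local Open Scope ereal_scope.
Context d1 d2 d3 d4 (T1 : measurableType d1) (T2 : measurableType d2)
  (T3 : measurableType d3) (T4 : measurableType d4) (R : realType).
Variables (m1 : {sigma_finite_measure set T1 -> \bar R})
  (m2 : {sigma_finite_measure set T2 -> \bar R})
  (m3 : {sigma_finite_measure set T3 -> \bar R})
  (m4 : {sigma_finite_measure set T4 -> \bar R}).

(** The model describes laws by iterated integrals, while [ge0_integral_density] compares two
    measures on one space. Tonelli, applied three times, supplies the second measure. *)
Lemma iterated_integral_measure :
  exists m : {measure set (T1 * T2 * T3 * T4)%type -> \bar R},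
    forall F : T1 * T2 * T3 * T4 -> \bar R,
    measurable_fun [set: T1 * T2 * T3 * T4] F -> (forall p, 0 <= F p) ->
    \int[m1]_x \int[m2]_t \int[m3]_l \int[m4]_s F (x, t, l, s) = \int[m]_p F p.
Proof.
pose m12 := sigma_product m1 m2; pose m123 := sigma_product m12 m3.
exists (sigma_product m123 m4) => F mF F0; apply/esym.
have mF1 := measurable_fun_fubini_tonelli_F (m2 := m4) F mF F0.
have p1 x : 0 <= fubini_F m4 F x by apply: integral_ge0.
have mF2 := measurable_fun_fubini_tonelli_F (m2 := m3) _ mF1 p1.
have p2 x : 0 <= fubini_F m3 (fubini_F m4 F) x by apply: integral_ge0.
apply: etrans (fubini_tonelli1 (m1 := m123) F mF F0) _.
apply: etrans (fubini_tonelli1 (m1 := m12) _ mF1 p1) _.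
exact: (fubini_tonelli1 (m1 := m1) _ mF2 p2).
Qed.

(** Brings the observation and [theta] innermost, where they can be integrated out in closed form.
    With right-nested coordinates, first [x] and then [t] is moved past the whole remaining block by
    Tonelli. *)
Lemma iterated_integral_swap (F : T1 * T2 * T3 * T4 -> \bar R) :
  measurable_fun [set: T1 * T2 * T3 * T4] F -> (forall p, 0 <= F p) ->
  \int[m1]_x \int[m2]_t \int[m3]_l \int[m4]_s F (x, t, l, s) =
  \int[m3]_l \int[m4]_s \int[m2]_t \int[m1]_x F (x, t, l, s).
Proof.
move=> mF F0.
pose m34 := sigma_product m3 m4; pose m234 := sigma_product m2 m34.
pose G (q : T1 * (T2 * (T3 * T4))) := F (q.1, q.2.1, q.2.2.1, q.2.2.2).
have mG : measurable_fun [set: T1 * (T2 * (T3 * T4))] G.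
  apply: measurableT_comp => //.
  by repeat apply: measurable_fun_pair => //=; repeat apply: measurableT_comp.
have G0 q : 0 <= G q by exact: F0.
transitivity (\int[m1]_x \int[m234]_q G (x, q)).
  apply: eq_integral => x _.
  have mGx : measurable_fun setT (fun q => G (x, q)) by exact: measurableT_comp.
  have Gx0 q : 0 <= G (x, q) by [].
  apply/esym; apply: etrans (fubini_tonelli1 (m2 := m34) _ mGx Gx0) _.
  apply: eq_integral => t _.
  have mGxt : measurable_fun setT (fun q => G (x, (t, q))).
    exact: (measurableT_comp mGx).
  exact: (fubini_tonelli1 (m1 := m3) (m2 := m4) _ mGxt).
apply: etrans (fubini_tonelli (m2 := m234) G mG G0) _.
have mH := measurable_fun_fubini_tonelli_G (m1 := m1) _ mG G0.
have H0 q : 0 <= fubini_G m1 G q by apply: integral_ge0.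
apply: etrans (fubini_tonelli2 (m1 := m2) (m2 := m34) _ mH H0) _.
have mK := measurable_fun_fubini_tonelli_G (m1 := m2) _ mH H0.
apply: etrans (fubini_tonelli1 (m1 := m3) (m2 := m4) _ mK _) _ => //.
by move=> q; apply: integral_ge0.
Qed.

Lemma ge0_integral_iterated_density
    (nu : {measure set (T1 * T2 * T3 * T4)%type -> \bar R})
    (f : T1 * T2 * T3 * T4 -> R) (g : T1 * T2 * T3 * T4 -> \bar R) :
  measurable_fun [set: T1 * T2 * T3 * T4] f -> (forall p, (0 <= f p)%R) ->
  (forall A, measurable A -> nu A = \int[m1]_x \int[m2]_t \int[m3]_l \int[m4]_s
      (f (x, t, l, s) * \1_A (x, t, l, s))%:E) ->
  measurable_fun [set: T1 * T2 * T3 * T4] g -> (forall p, 0 <= g p) ->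
  \int[nu]_p g p = \int[m3]_l \int[m4]_s \int[m2]_t \int[m1]_x
      ((f (x, t, l, s))%:E * g (x, t, l, s)).
Proof.
move=> mf f0 nuE mg g0; have [m mE] := iterated_integral_measure.
have mfg : measurable_fun setT (fun p => (f p)%:E * g p).
  by apply: emeasurable_funM => //; exact/measurable_EFinP.
have fg0 p : 0 <= (f p)%:E * g p by rewrite mule_ge0 ?lee_fin.
rewrite -(iterated_integral_swap mfg fg0) (mE _ mfg fg0).
apply: ge0_integral_density => // A mA.
have mfA : measurable_fun setT (fun p => (f p * \1_A p)%:E).
  by apply/measurable_EFinP; apply: measurable_funM.
by rewrite nuE// (mE _ mfA)// => p; rewrite lee_fin mulr_ge0.
Qed.

End iterated.

(** * The densities of the hierarchy and the Gaussian convolution *)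

Section densities.
Context {R : realType}.
Implicit Types (m v x t s l tau K a r : R) (L : R -> R).
Notation mu := (@lebesgue_measure R).

(** On nonnegative reals the inverse is the power with exponent -1, even at 0, where both take the
    value 0. *)
Lemma ge0_measurable_fun_invr d (T : measurableType d) (f : T -> R) :
  (forall w, 0 <= f w) ->
  measurable_fun setT f -> measurable_fun setT (fun w => (f w)^-1).
Proof.
move=> f0 mf; under eq_fun do rewrite -powR_inv1//.
exact: (measurableT_comp (measurable_powR (- 1))).
Qed.

Lemma measurable_sqrt : measurable_fun setT (@Num.sqrt R).
Proof. by apply: continuous_measurable_fun; exact: sqrt_continuous. Qed.

Lemma measurable_fun_normal_var_pdf d (T : measurableType d) (m v x : T -> R) :
  measurable_fun setT m -> measurable_fun setT v -> measurable_fun setT x ->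
  measurable_fun setT (fun w => normal_var_pdf (m w) (v w) (x w)).
Proof.
move=> mm mv mx; rewrite /normal_var_pdf /normal_pdf.
have msv : measurable_fun setT (fun w => Num.sqrt (v w)).
  exact: measurableT_comp measurable_sqrt mv.
apply: measurable_fun_ifT.
- exact: measurable_fun_eqr.
- by apply: measurableT_comp => //; exact: measurable_indic.
- apply: measurable_funM.
  + apply: ge0_measurable_fun_invr => //.
    apply: (measurableT_comp measurable_sqrt).
    apply: measurable_funD => //;
    by apply: measurable_funM => //; exact: measurable_funX.
  + apply: (@measurableT_comp _ _ _ _ _ _ (@expR R)) => //.
    apply: measurable_funM.
      by apply: measurable_funN; apply: measurable_funX; exact: measurable_funB.
    by apply: ge0_measurable_fun_invr => [w|]; [rewrite mulrn_wge0 ?sqr_ge0|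
      apply: measurable_funD; exact: measurable_funX].
Qed.

Lemma normal_var_pdf_ge0 m v x : 0 <= normal_var_pdf m v x.
Proof. exact: normal_pdf_ge0. Qed.

Lemma normal_var_pdfE m v x : 0 < v -> normal_var_pdf m v x =
  (Num.sqrt (v * pi *+ 2))^-1 * expR (- (x - m) ^+ 2 / (v *+ 2)).
Proof.
move=> v0; rewrite /normal_var_pdf normal_pdfE ?gt_eqF ?sqrtr_gt0//.
by rewrite /normal_peak /normal_fun sqr_sqrtr// ltW.
Qed.

Lemma integral_normal_var_pdf m v :
  (\int[mu]_x (normal_var_pdf m v x)%:E = 1)%E.
Proof. exact: integral_normal_pdf. Qed.

(* Completing the square in [t]. *)
Lemma normal_var_pdf_mul x t s v : 0 < s -> 0 < v ->
  normal_var_pdf t s x * normal_var_pdf 0 v t = normal_var_pdf 0 (s + v) x *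
    normal_var_pdf (x * v / (s + v)) (s * v / (s + v)) t.
Proof.
move=> s0 v0; have sv0 : 0 < s + v by rewrite addr_gt0.
rewrite !normal_var_pdfE ?divr_gt0 ?mulr_gt0//.
rewrite mulrACA [RHS]mulrACA -!expRD -!invfM -!sqrtrM;
  try by rewrite ltW// pmulrn_lgt0// mulr_gt0 ?pi_gt0.
congr (_^-1 * expR _); first (congr Num.sqrt); by field; lra.
Qed.

(** After completing the square one factor is free of [t] and the other is a normal density in [t],
    of total mass 1. *)
Lemma normal_convolution x s v : 0 < s -> 0 < v ->
  (\int[mu]_t (normal_var_pdf t s x * normal_var_pdf 0 v t)%:E =
   (normal_var_pdf 0 (s + v) x)%:E)%E.
Proof.
move=> s0 v0; under eq_integral do rewrite normal_var_pdf_mul// EFinM.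
rewrite ge0_integralZl//.
- by rewrite integral_normal_var_pdf mule1.
- by apply/measurable_EFinP; exact: measurable_fun_normal_var_pdf.
- by move=> t _; rewrite lee_fin normal_var_pdf_ge0.
- by rewrite lee_fin normal_var_pdf_ge0.
Qed.

Lemma sigma2_pdf_ge0 s : 0 <= sigma2_pdf s.
Proof. by rewrite /sigma2_pdf; case: ifP => // _; rewrite mulr_ge0 ?expR_ge0. Qed.

Lemma measurable_sigma2_pdf : measurable_fun setT (@sigma2_pdf R).
Proof.
apply: measurable_fun_ifT => //.
  exact: measurable_fun_ltr.
apply: measurable_funM => //; apply: measurableT_comp => //.
by apply: measurable_funN; exact: measurable_funM.
Qed.

Lemma lambda2_pdf_ge0 K a L l : 0 <= K -> (forall u : R, 0 < u -> 0 <= L u) ->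
  0 <= lambda2_pdf K a L l.
Proof.
move=> K0 L0; rewrite /lambda2_pdf; case: ifPn => // l0.
by rewrite !mulr_ge0 ?powR_ge0 ?L0.
Qed.

Lemma measurable_lambda2_pdf K a L : (forall u : R, 0 < u -> 0 <= L u) ->
  (forall u v : R, 0 < u -> u <= v -> L u <= L v) ->
  measurable_fun setT (lambda2_pdf K a L).
Proof.
(* [L] is constrained only on positive arguments. Its extension by 0 is nondecreasing on the whole
   line, hence measurable. *)
move=> L0 Lnd; pose L' u := if 0 < u then L u else 0.
have mL' : measurable_fun setT L'.
  apply: nondecreasing_measurable => // u v uv; rewrite /L'.
  have [u0|u0] := ltP 0 u; first by rewrite (lt_le_trans u0 uv) Lnd.
  by case: ifPn => // /L0.
have -> : lambda2_pdf K a L =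
    fun u => K * u `^ (- a - 1) * L' u.
  by apply/funext => u; rewrite /lambda2_pdf /L'; case: ifPn; rewrite ?mulr0.
by apply: measurable_funM => //; exact: measurable_funM.
Qed.

End densities.

(** * Integrating the observation and the mean out of the joint density *)

Section joint_law.
Context (R : realType) (a K tau : R) (L : R -> R).
Hypotheses (K0 : 0 <= K) (L0 : forall u : R, 0 < u -> 0 <= L u)
  (Lnd : forall u v : R, 0 < u -> u <= v -> L u <= L v) (tau0 : 0 < tau).
Notation mu := (@lebesgue_measure R).

Lemma joint_pdf_ge0 (p : R * R * R * R) : 0 <= joint_pdf K a L tau p.
Proof.
case: p => -[[x t] l] s; rewrite /joint_pdf.
by rewrite !mulr_ge0 ?normal_var_pdf_ge0 ?lambda2_pdf_ge0 ?sigma2_pdf_ge0.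
Qed.

Lemma measurable_joint_pdf : measurable_fun setT (joint_pdf K a L tau).
Proof.
have -> : joint_pdf K a L tau = fun p =>
  normal_var_pdf p.1.1.2 p.2 p.1.1.1 *
  normal_var_pdf 0 (p.2 * p.1.2 * tau ^+ 2) p.1.1.2 *
  lambda2_pdf K a L p.1.2 * sigma2_pdf p.2 by apply/funext => -[[[x t] l] s].
have m1 : measurable_fun setT (fun p : R * R * R * R => p.1.1.1).
  by repeat apply: measurableT_comp.
have m2 : measurable_fun setT (fun p : R * R * R * R => p.1.1.2).
  by repeat apply: measurableT_comp.
have m3 : measurable_fun setT (fun p : R * R * R * R => p.1.2).
  by repeat apply: measurableT_comp.
have m4 : measurable_fun setT (fun p : R * R * R * R => p.2).
  exact: measurable_snd.
apply: measurable_funM; last first.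
  by apply: measurableT_comp => //; exact: measurable_sigma2_pdf.
apply: measurable_funM; last first.
  exact: measurableT_comp (measurable_lambda2_pdf K a L0 Lnd) m3.
apply: measurable_funM; apply: measurable_fun_normal_var_pdf => //.
by apply: measurable_funM => //; exact: measurable_funM.
Qed.

(** Here [y] is the observation drawn in the model and [x] the value conditioned on. The density of
    [y] has mass 1 and disappears; the likelihood at [x] is then convolved with the prior of
    [theta]. *)
Lemma integral_joint_pdf (c x l s : R) : 0 <= c ->
  (\int[mu]_t \int[mu]_y
    ((joint_pdf K a L tau (y, t, l, s))%:E * (c * normal_var_pdf t s x)%:E) =
  (c * lambda2_pdf K a L l * (sigma2_pdf s
     * normal_var_pdf 0 (s * (1 + l * tau ^+ 2)) x))%:E)%E.
Proof.
move=> c0.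
transitivity (\int[mu]_t ((c * lambda2_pdf K a L l * sigma2_pdf s *
    (normal_var_pdf t s x * normal_var_pdf 0 (s * l * tau ^+ 2) t))%:E))%E.
  apply: eq_integral => t _.
  transitivity (\int[mu]_y ((c * lambda2_pdf K a L l * sigma2_pdf s *
      (normal_var_pdf t s x * normal_var_pdf 0 (s * l * tau ^+ 2) t))%:E *
      (normal_var_pdf t s y)%:E))%E.
    by apply: eq_integral => y _; rewrite -!EFinM /joint_pdf; congr EFin; ring.
  rewrite ge0_integralZl//.
  - by rewrite integral_normal_var_pdf mule1.
  - by apply/measurable_EFinP; exact: measurable_fun_normal_var_pdf.
  - by move=> y _; rewrite lee_fin normal_var_pdf_ge0.
  - by rewrite lee_fin !mulr_ge0 ?normal_var_pdf_ge0 ?lambda2_pdf_ge0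
      ?sigma2_pdf_ge0.
(* The convolution needs positive variances. For [l] or [s] nonpositive a prior density vanishes and
   both sides are 0. *)
have [l0|l0] := leP l 0.
  rewrite {2}/lambda2_pdf (ltNge 0 l) l0 !(mulr0, mul0r).
  by apply: integral0_eq => t _; rewrite /lambda2_pdf (ltNge 0 l) l0 !(mulr0, mul0r).
have [s0|s0] := leP s 0.
  rewrite {2}/sigma2_pdf (ltNge 0 s) s0 !(mulr0, mul0r).
  by apply: integral0_eq => t _; rewrite /sigma2_pdf (ltNge 0 s) s0 !(mulr0, mul0r).
under eq_integral do rewrite EFinM.
rewrite ge0_integralZl//.
- rewrite normal_convolution ?mulr_gt0 ?exprn_gt0// -EFinM mulrA.
  by rewrite mulrDr mulr1 mulrA.
- apply/measurable_EFinP; apply: measurable_funM;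
  exact: measurable_fun_normal_var_pdf.
- by move=> t _; rewrite lee_fin mulr_ge0 ?normal_var_pdf_ge0.
- by rewrite lee_fin !mulr_ge0 ?lambda2_pdf_ge0 ?sigma2_pdf_ge0.
Qed.

End joint_law.

(** * From expectations under [P] to double integrals over [l] and [s] *)

Section marginal_likelihood.
Context (R : realType) (a K tau : R) (L : R -> R).
Hypotheses (K0 : 0 <= K) (L0 : forall u : R, 0 < u -> 0 <= L u)
  (Lnd : forall u v : R, 0 < u -> u <= v -> L u <= L v) (tau0 : 0 < tau).
Context (d : measure_display) (T : measurableType d) (P : probability T R)
  (n : nat) (X theta lambda2 sigma2 : 'I_n -> {RV P >-> R}).
Hypothesis model : hierarchical_model X theta lambda2 sigma2 K a L tau.
Notation mu := (@lebesgue_measure R).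

(** The expectation is pushed forward to the law of the quadruple, whose density is [joint_pdf]. It
    serves both parts of the posterior ratio: [h] is the absolute value of [1 - shrinkage] above and
    the constant 1 below. *)
Lemma integral_weighted_likelihood (i : 'I_n) (h : R -> R) (x : R) :
  measurable_fun setT h -> (forall l, 0 <= h l) ->
  (\int[P]_w (h (lambda2 i w) * normal_var_pdf (theta i w) (sigma2 i w) x)%:E =
   \int[mu]_l \int[mu]_s (h l * lambda2_pdf K a L l * (sigma2_pdf s
     * normal_var_pdf 0 (s * (1 + l * tau ^+ 2)) x))%:E)%E.
Proof.
move=> mh h0.
pose g (p : R * R * R * R) := (h p.1.2 * normal_var_pdf p.1.1.2 p.2 x)%:E.
have mg : measurable_fun setT g.
  apply/measurable_EFinP; apply: measurable_funM.
    by apply: (measurableT_comp mh); repeat apply: measurableT_comp.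
  by apply: measurable_fun_normal_var_pdf => //; repeat apply: measurableT_comp.
have g0 p : (0 <= g p)%E by rewrite lee_fin mulr_ge0 ?normal_var_pdf_ge0.
have mf : measurable_fun setT (joint_pdf K a L tau) by exact: measurable_joint_pdf.
have f0 p : 0 <= joint_pdf K a L tau p by exact: joint_pdf_ge0.
(* [mu] is a measure on [measurableTypeR R], whose display is not that of [R]. *)
pose mR := measurableTypeR R.
have mRV (Z : {RV P >-> R}) : measurable_fun setT (Z : T -> mR).
  exact: (measurable_funPT Z).
have mY : measurable_fun setT
    (unit_of X theta lambda2 sigma2 i : T -> (mR * mR * mR * mR)%type).
  by repeat (apply: measurable_fun_pair; last exact: mRV); exact: mRV.
pose Y : {mfun T >-> (mR * mR * mR * mR)%type} :=
  HB.pack (unit_of X theta lambda2 sigma2 i)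
    (isMeasurableFun.Build _ _ _ _ _ mY).
have E := @ge0_integral_iterated_density _ _ _ _ mR mR mR mR R mu mu mu mu
  (distribution P Y) _ _ mf f0 _ mg g0.
transitivity (\int[distribution P Y]_p g p)%E.
  by rewrite ge0_integral_distribution.
rewrite E.
- apply: eq_integral => l _; apply: eq_integral => s _.
  rewrite -(@integral_joint_pdf R a K tau L K0 L0 tau0 (h l) x l s (h0 l)).
  by apply: eq_integral => t _; exact: eq_integral.
- by move=> A mA; exact: (model.2 i A mA).
Qed.

End marginal_likelihood.

(** * Integrability on the half-line by comparison with powers *)

Section power_integrals.
Context {R : realType}.
Implicit Types (p q c u v x : R) (f : R -> R).
Notation mu := (@lebesgue_measure R).

Lemma powR_derivable p x : 0 < x -> derivable (@powR R ^~ p) x 1.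
Proof. by move=> x0; apply: derivable_powR; rewrite in_itv/= x0. Qed.

Lemma integral_powR p u v : p != 0 -> 0 < u -> u < v ->
  (\int[mu]_(x in `[u, v]) (x `^ (p - 1))%:E = ((v `^ p - u `^ p) / p)%:E)%E.
Proof.
move=> p0 u0 uv; have v0 := lt_trans u0 uv.
have cvgF x : 0 < x -> y `^ p / p @[y --> x] --> x `^ p / p.
  move=> x0; apply: cvgMl.
  by have /derivable1_diffP/differentiable_continuous := @powR_derivable p x x0.
have dF x : 0 < x -> is_derive x 1 (fun y => y `^ p / p) (x `^ (p - 1)).
  move=> x0; have H := is_derive1_powR p x0.
  apply: is_derive_eq.
  by rewrite !scaler0 ?add0r ?addr0 /GRing.scale/= mulrA mulVf// mul1r.
rewrite (@continuous_FTC2 _ _ (fun x => x `^ p / p))//.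
- by rewrite -EFinB mulrBl.
- apply: derivable_within_continuous => x; rewrite in_itv/= => /andP[ux _].
  by apply: powR_derivable; exact: lt_le_trans ux.
- split.
  + by move=> x; rewrite in_itv/= => /andP[ux _]; apply: ex_derive;
      apply: dF; exact: lt_trans ux.
  + by apply: cvg_at_right_filter; exact: cvgF.
  + by apply: cvg_at_left_filter; exact: cvgF.
- move=> x; rewrite in_itv/= => /andP[ux _].
  have x0 := lt_trans u0 ux.
  by rewrite derive1E; have [_ ->] := dF x x0.
Qed.

(** The comparison powers have exponent above -1 near 0 and below -1 at infinity. Integrals over an
    exhausting sequence of compact intervals therefore stay bounded, and monotone convergence passes
    to the limit. *)
Lemma integral_powR_bound_lty f p q c : 0 < p -> q < 0 -> 0 <= c ->
  measurable_fun setT f -> (forall x, 0 <= f x) ->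
  (forall x, x <= 0 -> f x = 0) ->
  (forall x, 0 < x -> x <= 1 -> f x <= c * x `^ (p - 1)) ->
  (forall x, 1 <= x -> f x <= c * x `^ (q - 1)) ->
  (\int[mu]_x (f x)%:E < +oo)%E.
Proof.
move=> p0 q0 c0 mf f0 fN f1 f2.
(* The shift by 2 keeps 1 strictly inside every interval, so each can be cut at 1 into two
   nondegenerate pieces. *)
pose F n : set R := `[n.+2%:R^-1, n.+2%:R]%classic.
have inv01 n : 0 < n.+2%:R^-1 :> R by rewrite invr_gt0.
have inv1 n : n.+2%:R^-1 < 1 :> R by rewrite invf_lt1// ltr1n.
have mfD D : measurable_fun D (EFin \o f).
  by apply/measurable_EFinP; exact: measurable_funTS.
have ndF : nondecreasing_seq F.
  move=> m n mn; apply/subsetPset => x; rewrite /F/= !in_itv/= => /andP[a b].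
  rewrite (le_trans _ a) ?(le_trans b) ?ler_nat//.
  by rewrite lef_pV2 ?posrE// ler_nat.
have -> : (\int[mu]_x (f x)%:E = \int[mu]_(x in \bigcup_i F i) (f x)%:E)%E.
  rewrite [RHS]integral_mkcond; apply: eq_integral => x _.
  rewrite patchE; case: ifPn => // /negP xF; congr EFin; apply: fN.
  rewrite leNgt; apply/negP => x0; apply: xF; rewrite inE.
  pose N := maxn (Num.truncn x) (Num.truncn x^-1).
  exists N => //; rewrite /F/= in_itv/=; apply/andP; split.
  - rewrite invf_ple ?posrE// (le_trans (ltW (truncnS_gt _)))// ler_nat.
    by rewrite ltnS (leq_trans _ (leqnSn _))// leq_max leqnn orbT.
  - rewrite (le_trans (ltW (truncnS_gt _)))// ler_nat.
    by rewrite ltnS (leq_trans _ (leqnSn _))// leq_max leqnn.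
have cF : (\int[mu]_(x in F i) (f x)%:E @[i --> \oo] -->
    \int[mu]_(x in \bigcup_i F i) (f x)%:E)%E.
  apply: ge0_nondecreasing_set_cvg_integral => // [i|i|i x _].
  - exact: measurable_itv.
  - exact: mfD.
  - by rewrite lee_fin.
(* The two summands are the integrals of the comparison powers over (0, 1] and [1, +oo), so they do
   not depend on [n]. *)
suff H n : (\int[mu]_(x in F n) (f x)%:E <= (c / p + c / (- q))%:E)%E.
  by apply: le_lt_trans (ltry (c / p + c / - q)); apply: cvge_le cF; near=> n.
have -> : F n = `[n.+2%:R^-1, 1]%classic `|` `]1, n.+2%:R]%classic.
  rewrite -itv_bndbnd_setU// bnd_simp ?ltW ?inv1//.
  by rewrite ltr1n.
have bound r u v : r != 0 -> 0 < u -> u < v ->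
    (forall x, x \in `[u, v] -> f x <= c * x `^ (r - 1)) ->
    (\int[mu]_(x in `[u, v]) (f x)%:E <= (c * ((v `^ r - u `^ r) / r))%:E)%E.
  move=> r0 u0 uv fr; rewrite EFinM -integral_powR// -ge0_integralZl//.
  - apply: ge0_le_integral => //.
    + by move=> x _; rewrite lee_fin.
    + exact: mfD.
    + by apply: emeasurable_funM => //; apply/measurable_EFinP;
        apply: measurable_funTS; exact: measurable_powR.
  - by apply/measurable_EFinP; apply: measurable_funTS; exact: measurable_powR.
  - by move=> x _; rewrite lee_fin powR_ge0.
rewrite ge0_integral_setU//=; last 3 first.
- exact: mfD.
- by move=> x _; rewrite lee_fin.
- rewrite disj_set2E; apply/eqP/seteqP; split=> // x [] /=.
  by rewrite !in_itv/= => /andP[_ x1] /andP[x1']; rewrite leNgt x1' in x1.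
rewrite EFinD; apply: leeD.
- apply: le_trans (bound p _ _ _ _ _ _) _; rewrite ?gt_eqF//.
  + move=> x; rewrite in_itv/= => /andP[x0 x1].
    by apply: f1 => //; exact: lt_le_trans x0.
  + rewrite lee_fin ler_wpM2l// -[leRHS]div1r ler_pM2r ?invr_gt0//.
    by rewrite powR1 gerBl powR_ge0.
- apply: (@le_trans _ _ (\int[mu]_(x in `[1%R, n.+2%:R]) (f x)%:E)%E).
    apply: ge0_subset_integral => //; first exact: mfD.
      by move=> x _; rewrite lee_fin.
    by apply: subset_itvr; rewrite bnd_simp.
  apply: le_trans (bound q _ _ _ _ _ _) _; rewrite ?lt_eqF// ?ltr1n//.
  + by move=> x; rewrite in_itv/= => /andP[x0 _]; exact: f2.
  + rewrite lee_fin ler_wpM2l// -mulrNN -invrN -[leRHS]div1r.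
    rewrite ler_pM2r ?invr_gt0 ?oppr_gt0//.
    by rewrite powR1 opprB gerBl powR_ge0.
Unshelve. all: by end_near. Qed.

End power_integrals.

(** * Monotonicity and factorization of double integrals *)

Section double_integral.
Local Open Scope ereal_scope.
Context d1 d2 (T1 : measurableType d1) (T2 : measurableType d2) (R : realType).
Variables (m1 : {sigma_finite_measure set T1 -> \bar R})
  (m2 : {sigma_finite_measure set T2 -> \bar R}).

Lemma le_double_integral (F G : T1 * T2 -> R) :
  measurable_fun setT F -> measurable_fun setT G ->
  (forall p, (0 <= F p)%R) -> (forall p, (F p <= G p)%R) ->
  \int[m1]_x \int[m2]_y (F (x, y))%:E <= \int[m1]_x \int[m2]_y (G (x, y))%:E.
Proof.
move=> /measurable_EFinP mF /measurable_EFinP mG F0 FG.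
have p0 p : 0 <= (EFin \o F) p by rewrite lee_fin.
have q0 p : 0 <= (EFin \o G) p by rewrite lee_fin (le_trans (F0 p)).
apply: ge0_le_integral => //.
- by move=> x _; apply: integral_ge0 => y _; exact: (p0 (x, y)).
- exact: (measurable_fun_fubini_tonelli_F _ mF p0).
- exact: (measurable_fun_fubini_tonelli_F _ mG q0).
- move=> x _; apply: ge0_le_integral => //.
  + by move=> y _; exact: (p0 (x, y)).
  + exact: (measurableT_comp mF).
  + exact: (measurableT_comp mG).
  + by move=> y _; rewrite lee_fin.
Qed.

Lemma double_integral_mul (f : T1 -> R) (g : T2 -> R) :
  measurable_fun setT f -> measurable_fun setT g ->
  (forall x, (0 <= f x)%R) -> (forall y, (0 <= g y)%R) ->
  \int[m1]_x \int[m2]_y (f x * g y)%:E =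
  (\int[m1]_x (f x)%:E) * \int[m2]_y (g y)%:E.
Proof.
move=> mf mg f0 g0; rewrite -ge0_integralZr//.
- apply: eq_integral => x _; under eq_integral do rewrite EFinM.
  by rewrite ge0_integralZl//; [exact/measurable_EFinP|
    move=> y _; rewrite lee_fin|rewrite lee_fin].
- exact/measurable_EFinP.
- by move=> x _; rewrite lee_fin.
- by apply: integral_ge0 => y _; rewrite lee_fin.
Qed.

End double_integral.

(** * The shrinkage weight *)

Section shrinkage_bound.
Context {R : realType}.
Implicit Types (l tau eta x s : R).

Lemma shrinkage_gt0_bound l tau eta : 0 < l -> 0 < tau -> 0 < eta -> eta <= 1 ->
  `|1 - shrinkage tau l| <= tau `^ (2 * eta) * l `^ eta.
Proof.
move=> l0 tau0 eta0 eta1; rewrite powRrM (powR_mulrn 2) ?(ltW tau0)//.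
rewrite mulrC -powRM ?sqr_ge0 ?(ltW l0)//.
have : 0 < l * tau ^+ 2 by rewrite mulr_gt0 ?exprn_gt0.
rewrite /shrinkage; set z := l * tau ^+ 2 => z0.
have z1 : 0 < 1 + z by rewrite addr_gt0.
have -> : 1 - (1 + z)^-1 = z / (1 + z) by field; rewrite gt_eqF.
rewrite ger0_norm ?divr_ge0 ?(ltW z0) ?(ltW z1)// ler_pdivrMr//.
(* For [z <= 1] the exponent [eta <= 1] gives [z <= z^eta]; for [z > 1] one has [z^eta >= 1], and
   [z <= 1 + z] suffices. *)
have [z_le1|z_gt1] := leP z 1.
  apply: (@le_trans _ _ (z `^ eta)); first by rewrite ger1_powR ?z0.
  by rewrite ler_peMr ?powR_ge0// lerDl ltW.
apply: (@le_trans _ _ (1 + z)); first by rewrite lerDr.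
by rewrite ler_peMl ?(ltW z1)// -[leLHS](powRr0 z) ler_powR ?ltW.
Qed.

Lemma measurable_fun_invr d (T : measurableType d) (f : T -> R) :
  measurable_fun setT f -> measurable_fun setT (fun w => (f w)^-1).
Proof.
(* Writing 1/f as f/f^2 reduces to a nonnegative denominator; where [f] vanishes both sides are
   0. *)
move=> mf; have -> : (fun w => (f w)^-1) = (fun w => f w * (f w ^+ 2)^-1).
  apply/funext => w; have [->|fw0] := eqVneq (f w) 0; first by rewrite invr0 mul0r.
  by field.
apply: measurable_funM => //; apply: ge0_measurable_fun_invr => [w|].
- exact: sqr_ge0.
- exact: measurable_funX.
Qed.

Lemma measurable_shrinkage tau : measurable_fun setT (@shrinkage R tau).
Proof.
by apply: measurable_fun_invr; apply: measurable_funD => //; exact: measurable_funM.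
Qed.

End shrinkage_bound.

(** * Upper and lower bounds for the integrand in [s] *)

Section normal_bounds.
Context {R : realType}.
Implicit Types (x s y : R).
Notation mu := (@lebesgue_measure R).

(** The prior times the maximal height of the N(0, s) density: the majorant in [s], free of [x]. *)
Definition sigma2_peak s := sigma2_pdf s * (Num.sqrt (s * pi *+ 2))^-1.

Lemma sigma2_peak_ge0 s : 0 <= sigma2_peak s.
Proof. by rewrite mulr_ge0 ?sigma2_pdf_ge0 ?invr_ge0. Qed.

Lemma measurable_sigma2_peak : measurable_fun setT sigma2_peak.
Proof.
apply: measurable_funM; first exact: measurable_sigma2_pdf.
apply: ge0_measurable_fun_invr => //.
apply: (measurableT_comp measurable_sqrt).
by apply: measurable_funD; exact: measurable_funM.
Qed.

(** Near 0 the prior is at most 1, leaving [s^(-1/2)]. For [s >= 1] the inequality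
    [exp(s/2) >= 1 + s/2] bounds the prior by [1/s], leaving [s^(-3/2)]. *)
Lemma sigma2_peak_lty : (\int[mu]_s (sigma2_peak s)%:E < +oo)%E.
Proof.
have sqrtV s : 0 < s -> (Num.sqrt (s * pi *+ 2))^-1 <= s `^ (- 2^-1).
  move=> s0; rewrite powRN powR12_sqrt ?(ltW s0)// lef_pV2 ?posrE ?sqrtr_gt0//;
    last by rewrite pmulrn_lgt0// mulr_gt0 ?pi_gt0.
  apply: ler_wsqrtr; rewrite -mulrnAr ler_peMr ?(ltW s0)//.
  by have := pi_ge2 R; rewrite mulr2n; lra.
apply: (@integral_powR_bound_lty _ _ 2^-1 (- 2^-1) 1) => //.
- exact: measurable_sigma2_peak.
- exact: sigma2_peak_ge0.
- by move=> s s0; rewrite /sigma2_peak /sigma2_pdf ltNge s0 mul0r.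
- move=> s s0 s1; rewrite mul1r /sigma2_peak /sigma2_pdf s0.
  have -> : 2^-1 - 1 = - 2^-1 :> R by field.
  apply: le_trans (sqrtV _ s0); rewrite ler_piMl ?invr_ge0//.
  rewrite mulr_ile1 ?expR_ge0 ?invr_ge0 ?invf_le1 ?ler1n//.
  by rewrite -[leRHS]expR0 ler_expR oppr_le0 divr_ge0// ltW.
- move=> s s1; have s0 : 0 < s by exact: lt_le_trans s1.
  rewrite mul1r /sigma2_peak /sigma2_pdf s0.
  rewrite powRB; last by rewrite (gt_eqF s0) implybT.
  rewrite powRr1 ?(ltW s0)// mulrC ler_pM ?sqrtV ?invr_ge0 ?mulr_ge0 ?expR_ge0//.
  rewrite expRN -invfM lef_pV2 ?posrE ?mulr_gt0 ?expR_gt0//.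
  by have := expR_ge1Dx (s / 2); lra.
Qed.

(** The exponential is at most 1, and inflating the variance by [y >= 1] only lowers the peak. *)
Lemma normal_var_pdf_upper s y x : 0 < s -> 1 <= y ->
  normal_var_pdf 0 (s * y) x <= (Num.sqrt (s * pi *+ 2))^-1.
Proof.
move=> s0 y1; have y0 : 0 < y by exact: lt_le_trans y1.
have sp0 : 0 < s * pi *+ 2 by rewrite pmulrn_lgt0// mulr_gt0 ?pi_gt0.
have spy : s * y * pi *+ 2 = s * pi *+ 2 * y by ring.
rewrite normal_var_pdfE ?mulr_gt0// -[leRHS]mulr1 spy.
rewrite ler_pM ?invr_ge0 ?expR_ge0//.
- rewrite lef_pV2 ?posrE ?sqrtr_gt0 ?mulr_gt0//.
  by apply: ler_wsqrtr; rewrite ler_peMr// ltW.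
- rewrite -[leRHS]expR0 ler_expR mulNr oppr_le0 divr_ge0 ?sqr_ge0//.
  by rewrite mulrn_wge0// mulr_ge0 ?(ltW s0) ?(ltW y0).
Qed.

(* In the window [|x| < s <= |x| + sqrt |x| + 1] the exponent
   [x^2 / (2 s) + s / 2 = |x| + (s - |x|)^2 / (2 s)] exceeds [|x|] by at most 1. *)
Lemma sigma2_normal_lower s y x (q := Num.sqrt `|x|) : 1 <= y -> y <= 3 ->
  `|x| < s -> s <= `|x| + q + 1 ->
  expR (- 1) / (2 * Num.sqrt (6 * pi)) * expR (- `|x|) / (q + 1) <=
  sigma2_pdf s * normal_var_pdf 0 (s * y) x.
Proof.
move=> y1 y3 xs sx; have s0 : 0 < s by exact: le_lt_trans xs.
have y0 : 0 < y by exact: lt_le_trans y1.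
have q0 : 0 <= q by rewrite sqrtr_ge0.
have qx : `|x| = q ^+ 2 by rewrite sqr_sqrtr.
have pi0 := pi_gt0 R.
rewrite /sigma2_pdf s0 normal_var_pdfE ?mulr_gt0// subr0.
have q1 : 0 < q + 1 by rewrite ltr_wpDl.
have S0 : 0 < Num.sqrt (6 * pi) :> R by rewrite sqrtr_gt0 mulr_gt0.
have s1 : 0 < s * y * pi *+ 2 by rewrite pmulrn_lgt0// !mulr_gt0.
rewrite mulrACA -expRD.
have -> : expR (- 1) / (2 * Num.sqrt (6 * pi)) * expR (- `|x|) / (q + 1) =
    2^-1 * (Num.sqrt (6 * pi) * (q + 1))^-1 * expR (- 1 - `|x|).
  rewrite expRD; field.
  by rewrite (gt_eqF q1) (gt_eqF S0).
apply: ler_pM; rewrite ?expR_ge0// ?mulr_ge0 ?invr_ge0 ?mulr_ge0 ?(ltW q1)//.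
  (* The constant [6 * pi] is [3 * (2 * pi)]: [y <= 3], and [s <= q^2 + q + 1 <= (q + 1)^2]. *)
  rewrite ler_pM2l ?invr_gt0// lef_pV2 ?posrE ?mulr_gt0// ?sqrtr_gt0//.
  have -> : q + 1 = Num.sqrt ((q + 1) ^+ 2) 
    by rewrite sqrtr_sqr ger0_norm ?(ltW q1).
  rewrite -sqrtrM ?mulr_ge0 ?(ltW pi0)//; apply: ler_wsqrtr.
  have -> : s * y * pi *+ 2 = (s * y) * (2 * pi) by ring.
  have -> : 6 * pi * (q + 1) ^+ 2 = ((q + 1) ^+ 2 * 3) * (2 * pi) :> R by ring.
  rewrite ler_wpM2r ?mulr_ge0 ?(ltW pi0)// ler_pM ?(ltW s0) ?(ltW y0)//.
  by rewrite (le_trans sx)// qx; nra.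
rewrite ler_expR.
have -> : - x ^+ 2 / (s * y *+ 2) = - (`|x| ^+ 2 / (s *+ 2) / y).
  rewrite real_normK ?num_real//; field.
  by rewrite !gt_eqF.
apply: (@le_trans _ _ (- (s / 2) - `|x| ^+ 2 / (s *+ 2))); last first.
  rewrite lerD2l lerN2 ler_pdivrMr// ler_peMr// divr_ge0 ?sqr_ge0//.
  by rewrite mulrn_wge0// ltW.
(* With [v = s - q^2]: if [v <= 1] then [v^2 <= v <= s]; otherwise [v - 1] lies between 0 and [q],
   so [v^2 <= q^2 + 2v - 1 <= 2s]. *)
have H : (s - q ^+ 2) ^+ 2 <= 2 * s.
  rewrite qx in xs sx; have [v1|v1] := leP (s - q ^+ 2) 1; first by nra.
  suff : (s - q ^+ 2 - 1) ^+ 2 <= q ^+ 2 by nra.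
  by rewrite lerXn2r ?nnegrE//; lra.
rewrite qx -subr_ge0.
have -> : - (s / 2) - (q ^+ 2) ^+ 2 / (s *+ 2) - (- 1 - q ^+ 2) =
    (2 * s - (s - q ^+ 2) ^+ 2) / (2 * s) by field; rewrite gt_eqF.
by rewrite divr_ge0 ?subr_ge0// mulr_ge0// ltW.
Qed.

End normal_bounds.

(** * Bounds on the numerator and the denominator of the posterior ratio *)

Section posterior_bounds.
Context (R : realType) (a K M eta : R) (L : R -> R).
Hypotheses (K_gt0 : 0 < K)
  (Lnd : forall u v : R, 0 < u -> u <= v -> L u <= L v)
  (L_bounded : forall u : R, 0 < u -> 0 < L u /\ L u <= M)
  (K_normalizing :
    (\int[@lebesgue_measure R]_u (lambda2_pdf K a L u)%:E = 1)%E)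
  (eta_gt0 : 0 < eta) (eta_lta : eta < a) (eta_le1 : eta <= 1).
Notation mu := (@lebesgue_measure R).
Implicit Types (tau l s x : R) (h : R -> R).

Let L0 (u : R) : 0 < u -> 0 <= L u.
Proof. by move=> /L_bounded[/ltW]. Qed.

Let mlambda2 : measurable_fun setT (lambda2_pdf K a L).
Proof. exact: measurable_lambda2_pdf. Qed.

Let lambda2_ge0 l : 0 <= lambda2_pdf K a L l.
Proof. by apply: lambda2_pdf_ge0 => //; exact: ltW. Qed.

(** The range is split at 1. Below, [l^eta <= 1] and the normalization of the prior bounds the
    integral; above, [L <= M] leaves the power [eta - a - 1], which is below -1. *)
Lemma lambda2_moment_lty :
  (\int[mu]_l (l `^ eta * lambda2_pdf K a L l)%:E < +oo)%E.
Proof.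
pose g l := if 1 < l then l `^ eta * lambda2_pdf K a L l else 0.
have mll : measurable_fun setT (fun l => l `^ eta * lambda2_pdf K a L l).
  by apply: measurable_funM => //; exact: measurable_powR.
have mg : measurable_fun setT g.
  by apply: measurable_fun_ifT => //; exact: measurable_fun_ltr.
have g0 l : 0 <= g l.
  by rewrite /g; case: ifP => // _; rewrite mulr_ge0 ?powR_ge0.
apply: (@le_lt_trans _ _
    (\int[mu]_l ((lambda2_pdf K a L l)%:E + (g l)%:E))%E).
  apply: ge0_le_integral => //.
  - by move=> l _; rewrite lee_fin mulr_ge0 ?powR_ge0.
  - exact/measurable_EFinP.
  - by apply: emeasurable_funD; exact/measurable_EFinP.
  - move=> l _; rewrite -EFinD lee_fin /g.
    have [l0|l0] := leP l 0.
      by rewrite /lambda2_pdf (ltNge 0 l) l0 mulr0 add0r; case: ifP.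
    have [l1|l1] := ltP 1 l; first by rewrite lerDr.
    rewrite addr0 ler_piMl// -(powRr0 l).
    by rewrite ger_powR ?l0// ltW.
rewrite ge0_integralD//.
- rewrite K_normalizing lte_add_pinfty ?ltry//.
  (* Since [g] vanishes up to 1, the first exponent is an arbitrary positive choice. *)
  apply: (@integral_powR_bound_lty _ _ 1 (eta - a) (K * M)) => //.
  + by rewrite subr_lt0.
  + have [L1 LM] := L_bounded ltr01.
    by rewrite mulr_ge0 ?(ltW K_gt0)// (le_trans _ LM)// ltW.
  + by move=> l l0; rewrite /g ltNge (le_trans l0 ler01).
  + move=> l l0 l1; rewrite /g ltNge l1 mulr_ge0 ?powR_ge0//.
    have [L1 LM] := L_bounded ltr01.
    by rewrite mulr_ge0 ?(ltW K_gt0)// (le_trans _ LM)// ltW.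
  + move=> l l1; have l0 : 0 < l by exact: lt_le_trans l1.
    have [Ll LM] := L_bounded l0.
    have M0 : 0 <= M by exact: le_trans (ltW Ll) LM.
    rewrite /g /lambda2_pdf l0; case: ifP => _; last first.
      by rewrite !mulr_ge0 ?powR_ge0 ?(ltW K_gt0).
    have -> : eta - a - 1 = eta + (- a - 1) by ring.
    rewrite powRD; last by rewrite (gt_eqF l0) implybT.
    have -> : l `^ eta * (K * l `^ (- a - 1) * L l) =
      K * L l * (l `^ eta * l `^ (- a - 1)) by ring.
    by rewrite ler_wpM2r ?mulr_ge0 ?powR_ge0// ler_wpM2l// ltW.
- by move=> l _; rewrite lee_fin.
- exact/measurable_EFinP.
- by move=> l _; rewrite lee_fin.
- exact/measurable_EFinP.
Qed.

Definition weighted_density h tau x (p : R * R) : R :=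
  h p.1 * lambda2_pdf K a L p.1 *
  (sigma2_pdf p.2 * normal_var_pdf 0 (p.2 * (1 + p.1 * tau ^+ 2)) x).

Lemma weighted_density_ge0 h tau x p :
  (forall l, 0 <= h l) -> 0 <= weighted_density h tau x p.
Proof.
by move=> h0; rewrite !mulr_ge0 ?sigma2_pdf_ge0 ?normal_var_pdf_ge0.
Qed.

Lemma measurable_weighted_density h tau x :
  measurable_fun setT h -> measurable_fun setT (weighted_density h tau x).
Proof.
move=> mh.
have m1 : measurable_fun setT (fun p : R * R => p.1) by exact: measurable_fst.
have m2 : measurable_fun setT (fun p : R * R => p.2) by exact: measurable_snd.
apply: measurable_funM.
  by apply: measurable_funM; [exact: (measurableT_comp mh m1)|
    exact: (measurableT_comp mlambda2 m1)].
apply: measurable_funM.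
  exact: (measurableT_comp (@measurable_sigma2_pdf R) m2).
apply: measurable_fun_normal_var_pdf => //; apply: measurable_funM => //.
by apply: measurable_funD => //; exact: measurable_funM.
Qed.

(** The integrand is dominated by a function of [l] times a function of [s], so the bound factorizes
    and is uniform in [x]. *)
Lemma weighted_density_upper tau x : 0 < tau ->
  (\int[mu]_l \int[mu]_s
    (weighted_density (fun l => `|1 - shrinkage tau l|) tau x (l, s))%:E <=
  (tau `^ (2 * eta))%:E * (\int[mu]_l (l `^ eta * lambda2_pdf K a L l)%:E *
    \int[mu]_s (sigma2_peak s)%:E))%E.
Proof.
move=> tau0.
pose f l := tau `^ (2 * eta) * (l `^ eta * lambda2_pdf K a L l).
have mll : measurable_fun setT (fun l => l `^ eta * lambda2_pdf K a L l).
  by apply: measurable_funM => //; exact: measurable_powR.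
have mf : measurable_fun setT f by exact: measurable_funM.
have ll0 l : 0 <= l `^ eta * lambda2_pdf K a L l.
  by rewrite mulr_ge0 ?powR_ge0.
have f0 l : 0 <= f l by rewrite mulr_ge0 ?powR_ge0.
have mp := @measurable_sigma2_peak R.
have mh : measurable_fun setT (fun l => `|1 - shrinkage tau l|).
  apply: measurableT_comp => //; apply: measurable_funB => //.
  exact: measurable_shrinkage.
have -> : ((tau `^ (2 * eta))%:E * (\int[mu]_l (l `^ eta * lambda2_pdf K a L l)%:E
    * \int[mu]_s (sigma2_peak s)%:E) =
    \int[mu]_l (f l)%:E * \int[mu]_s (sigma2_peak s)%:E)%E.
  rewrite muleA; congr (_ * _)%E; rewrite -ge0_integralZl//.
  - exact/measurable_EFinP.
  - by move=> l _; rewrite lee_fin.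
  - by rewrite lee_fin powR_ge0.
rewrite -(double_integral_mul mu mu mf mp f0 (@sigma2_peak_ge0 R)).
apply: (@le_double_integral _ _ _ _ R mu mu _ (fun p => f p.1 * sigma2_peak p.2)).
- exact: measurable_weighted_density.
- by apply: measurable_funM; [exact: (measurableT_comp mf)|
    exact: (measurableT_comp mp)].
- by move=> p; apply: weighted_density_ge0.
move=> [l s]; rewrite /weighted_density/=.
have [l0|l0] := leP l 0.
  by rewrite /f /lambda2_pdf ltNge l0 !(mulr0, mul0r).
have [s0|s0] := leP s 0.
  by rewrite /sigma2_peak /sigma2_pdf ltNge s0 !(mulr0, mul0r).
apply: ler_pM; rewrite ?mulr_ge0 ?sigma2_pdf_ge0 ?normal_var_pdf_ge0//.
- by rewrite /f mulrA ler_wpM2r ?shrinkage_gt0_bound.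
- rewrite ler_wpM2l ?sigma2_pdf_ge0// normal_var_pdf_upper//.
  by rewrite lerDl mulr_ge0 ?sqr_ge0 ?(ltW l0).
Qed.

(** The minorant of the prior of [l] on [1, 2], an interval of length 1, times the constant of
    [sigma2_normal_lower]. *)
Definition likelihood_constant : R :=
  K * 2 `^ (- a - 1) * L 1 * (expR (- 1) / (2 * Num.sqrt (6 * pi))).

Lemma likelihood_constant_gt0 : 0 < likelihood_constant.
Proof.
have [L1 _] := L_bounded ltr01.
by rewrite !mulr_gt0 ?powR_gt0 ?expR_gt0 ?invr_gt0 ?mulr_gt0 ?sqrtr_gt0
  ?mulr_gt0 ?pi_gt0.
Qed.

Lemma lambda2_pdf_lower l : 0 < a -> 1 <= l -> l <= 2 ->
  K * 2 `^ (- a - 1) * L 1 <= lambda2_pdf K a L l.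
Proof.
move=> a0 l1 l2; have l0 : 0 < l by exact: lt_le_trans l1.
have [L1 _] := L_bounded ltr01.
rewrite /lambda2_pdf l0 ler_pM ?(ltW L1) ?mulr_ge0 ?powR_ge0 ?(ltW K_gt0) ?Lnd//.
rewrite ler_wpM2l ?(ltW K_gt0)//.
have -> : - a - 1 = - (a + 1) by ring.
rewrite !powRN lef_pV2 ?posrE ?powR_gt0//.
by apply: ge0_ler_powR; rewrite ?nnegrE ?addr_ge0 ?(ltW a0) ?(ltW l0).
Qed.

(** The integrand is minorized by a constant on the rectangle [I] times [J]. The length [q + 1] of
    [J] cancels the factor [1 / (q + 1)] of [sigma2_normal_lower], so exactly [exp(-|x|)]
    remains. *)
Lemma weighted_density_lower tau x : 0 < tau -> tau < 1 ->
  ((likelihood_constant * expR (- `|x|))%:E <= \int[mu]_l \int[mu]_s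
    (weighted_density (cst 1) tau x (l, s))%:E)%E.
Proof.
move=> tau0 tau1; have a0 : 0 < a by exact: lt_trans eta_lta.
have [L1 _] := L_bounded ltr01.
pose q := Num.sqrt `|x|.
have q1 : 0 < q + 1 by rewrite ltr_wpDl ?sqrtr_ge0.
pose I : set R := `[1%R, 2%R]%classic.
pose J : set R := `]`|x|, (`|x| + q + 1)]%classic.
pose c1 := K * 2 `^ (- a - 1) * L 1.
have c10 : 0 <= c1 by rewrite !mulr_ge0 ?powR_ge0 ?(ltW K_gt0) ?(ltW L1).
pose c2 := expR (- 1) / (2 * Num.sqrt (6 * pi)) * expR (- `|x|) / (q + 1) : R.
have c20 : 0 <= c2.
  by rewrite !mulr_ge0 ?invr_ge0 ?mulr_ge0 ?expR_ge0 ?sqrtr_ge0 ?(ltW q1).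
have mI : measurable I by exact: measurable_itv.
have mJ : measurable J by exact: measurable_itv.
pose f l : R := c1 * \1_I l; pose g s : R := c2 * \1_J s.
have mf : measurable_fun setT f by apply: measurable_funM.
have mg : measurable_fun setT g by apply: measurable_funM.
have f0 l : 0 <= f l by rewrite mulr_ge0.
have g0 s : 0 <= g s by rewrite mulr_ge0.
have muI : mu I = 1%:E.
  rewrite /I lebesgue_measure_itv/= lte_fin ltr1n.
  by rewrite -EFinB; congr EFin; ring.
have muJ : mu J = (q + 1)%:E.
  rewrite /J lebesgue_measure_itv/= lte_fin -addrA ltrDl q1.
  by rewrite -EFinB; congr EFin; ring.
have scaled c (A : set R) : 0 <= c -> measurable A ->
    (\int[mu]_l (c * \1_A l)%:E = c%:E * mu A)%E.
  move=> c0 mA; under eq_integral do rewrite EFinM.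
  rewrite ge0_integralZl//; last exact/measurable_EFinP.
  by rewrite integral_indic// setIT.
have fE : (\int[mu]_l (f l)%:E = c1%:E)%E by rewrite scaled// muI mule1.
have gE : (\int[mu]_s (g s)%:E = (c2 * (q + 1))%:E)%E.
  by rewrite scaled// muJ -EFinM.
have -> : (likelihood_constant * expR (- `|x|))%:E =
    (\int[mu]_l \int[mu]_s (f l * g s)%:E)%E.
  rewrite (double_integral_mul mu mu mf mg f0 g0) fE gE -EFinM; congr EFin.
  by rewrite /c1 /c2 /likelihood_constant divfK ?gt_eqF// !mulrA.
apply: (@le_double_integral _ _ _ _ R mu mu (fun p => f p.1 * g p.2)).
- by apply: measurable_funM; [exact: (measurableT_comp mf)|
    exact: (measurableT_comp mg)].
- exact: measurable_weighted_density.
- by move=> p; rewrite mulr_ge0.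
move=> [l s]; rewrite /weighted_density /f /g /= mul1r !indicE.
have rhs0 : 0 <= lambda2_pdf K a L l *
    (sigma2_pdf s * normal_var_pdf 0 (s * (1 + l * tau ^+ 2)) x).
  by rewrite !mulr_ge0 ?sigma2_pdf_ge0 ?normal_var_pdf_ge0.
have [|_] := boolP (l \in I); last by rewrite mulr0 mul0r.
rewrite inE /I/= in_itv/= => /andP[l1 l2].
have [|_] := boolP (s \in J); last by rewrite !mulr0.
rewrite inE /J/= in_itv/= => /andP[s1 s2].
rewrite !mulr1 ler_pM ?lambda2_pdf_lower// sigma2_normal_lower//.
- by rewrite lerDl mulr_ge0 ?sqr_ge0// (le_trans ler01).
(* [l <= 2] and [tau < 1] give [1 + l tau^2 <= 3], as [sigma2_normal_lower] demands. *)
- have : tau ^+ 2 <= 1 by rewrite expr_le1// ltW.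
  have := sqr_ge0 tau; nra.
Qed.

End posterior_bounds.

(** * Assembling the two bounds into the posterior ratio *)

Theorem lemma4p1 (R : realType) (a K M eta : R) (L : R -> R)
  (a_gt0 : 0 < a) (K_gt0 : 0 < K)
  (L_slow : slowly_varying L)
  (L_nondecreasing : forall u v : R, 0 < u -> u <= v -> L u <= L v)
  (L_bounded : forall u : R, 0 < u -> 0 < L u /\ L u <= M)
  (K_normalizing :
    (\int[@lebesgue_measure R]_u (lambda2_pdf K a L u)%:E = 1)%E)
  (eta_gt0 : 0 < eta) (eta_lt : eta < Num.min a (1 / 2)) :
  exists C : R, 0 < C /\
    forall tau : R, 0 < tau -> tau < 1 ->
    forall (d : measure_display) (T : measurableType d) (P : probability T R)
      (n : nat) (X theta lambda2 sigma2 : 'I_n -> {RV P >-> R}),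
    hierarchical_model X theta lambda2 sigma2 K a L tau ->
    forall (i : 'I_n) (x : R),
      posterior_expectation theta lambda2 sigma2 i
        (fun _ l _ => 1 - shrinkage tau l) x
      <= C * tau `^ (2 * eta) * expR `|x|.
Proof.
have [eta_lta eta_lt2] : eta < a /\ eta < 1 / 2.
  by move: eta_lt; rewrite lt_min => /andP.
have eta_le1 : eta <= 1 by lra.
have L0 (u : R) : 0 < u -> 0 <= L u by move=> /L_bounded[/ltW].
have ml := measurable_lambda2_pdf K a L0 L_nondecreasing.
have l0 l : 0 <= lambda2_pdf K a L l by apply: lambda2_pdf_ge0 => //; exact: ltW.
pose E := (\int[lebesgue_measure]_l (l `^ eta * lambda2_pdf K a L l)%:E)%E.
pose W := (\int[lebesgue_measure]_(s in [set: R]) (sigma2_peak s)%:E)%E.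
have E0 : (0 <= E)%E by apply: integral_ge0 => l _; rewrite lee_fin mulr_ge0 ?powR_ge0.
have W0 : (0 <= W)%E by apply: integral_ge0 => s _; rewrite lee_fin sigma2_peak_ge0.
have Eoo : (E < +oo)%E by exact: (lambda2_moment_lty K_gt0 L_nondecreasing L_bounded).
have Woo : (W < +oo)%E by exact: sigma2_peak_lty.
have EE : E = (fine E)%:E by rewrite fineK// ge0_fin_numE.
have WE : W = (fine W)%:E by rewrite fineK// ge0_fin_numE.
have fE0 : 0 <= fine E by exact: fine_ge0.
have fW0 : 0 <= fine W by exact: fine_ge0.
pose B := likelihood_constant a K L.
have B0 : 0 < B by exact: likelihood_constant_gt0 L_bounded.
(* Adding 1 makes the constant positive from the mere nonnegativity of [E] and [W]. *)
exists ((fine E * fine W + 1) / B); split.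
  by rewrite divr_gt0// ltr_wpDl// mulr_ge0.
move=> tau tau0 tau1 d T P n X theta lambda2 sigma2 model i x.
rewrite /posterior_expectation /=.
set N := (\int[P]_w _)%E; set D := (\int[P]_w _)%E.
have mshr : measurable_fun setT (fun l : R => 1 - shrinkage tau l).
  by apply: measurable_funB => //; exact: measurable_shrinkage.
(* [1 - shrinkage tau l] can be negative for negative [l], while [integral_weighted_likelihood] asks
   for a weight nonnegative everywhere; hence absolute values. *)
have NB : (`|N| <= (tau `^ (2 * eta) * (fine E * fine W))%:E)%E.
  apply: (@le_trans _ _ (\int[P]_w (`|1 - shrinkage tau (lambda2 i w)| *
      normal_var_pdf (theta i w) (sigma2 i w) x)%:E)%E).
    apply: le_trans (le_abse_integral _ _ _) _ => //.
      apply/measurable_EFinP; apply: measurable_funM.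
        exact: (measurableT_comp mshr).
      exact: measurable_fun_normal_var_pdf.
    under eq_integral do
      rewrite abse_EFin normrM (ger0_norm (normal_var_pdf_ge0 _ _ _)).
    by [].
  rewrite (integral_weighted_likelihood (ltW K_gt0) L0 L_nondecreasing tau0
    model i (h := fun l => `|1 - shrinkage tau l|))//; last first.
    exact: measurableT_comp.
  rewrite EFinM EFinM -EE -WE.
  exact: (weighted_density_upper a K_gt0 L_nondecreasing L_bounded).
have DB : ((B * expR (- `|x|))%:E <= D)%E.
  rewrite /D (_ : (\int[P]_w _)%E =
    (\int[P]_w (1 * normal_var_pdf (theta i w) (sigma2 i w) x)%:E)%E); last first.
    by apply: eq_integral => w _; rewrite mul1r.
  rewrite (integral_weighted_likelihood (ltW K_gt0) L0 L_nondecreasing tau0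
    model i (h := cst 1))//.
  exact: (weighted_density_lower K_gt0 L_nondecreasing L_bounded eta_gt0 eta_lta).
have rhs0 : 0 <= (fine E * fine W + 1) / B * tau `^ (2 * eta) * expR `|x|.
  by rewrite !mulr_ge0 ?expR_ge0 ?powR_ge0 ?invr_ge0 ?(ltW B0) ?addr_ge0 ?mulr_ge0.
have Nfin : fine N <= tau `^ (2 * eta) * (fine E * fine W).
  move: NB; case: (N) => [r| |] //=; rewrite lee_fin.
  by apply: le_trans; exact: ler_norm.
(* If [D] were infinite, [fine D] and its inverse would be 0, and the bound would be the
   nonnegativity [rhs0]. *)
case: (D) DB => [r|_|] //=; last by rewrite invr0 mulr0.
rewrite lee_fin => Br; have r0 : 0 < r.
  by apply: lt_le_trans Br; rewrite mulr_gt0 ?expR_gt0.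
rewrite ler_pdivrMr//; apply: (le_trans Nfin).
apply: le_trans (ler_wpM2l rhs0 Br).
have -> : (fine E * fine W + 1) / B * tau `^ (2 * eta) * expR `|x| *
    (B * expR (- `|x|)) = tau `^ (2 * eta) * (fine E * fine W + 1).
  rewrite expRN; field; by rewrite !gt_eqF ?expR_gt0.
by rewrite ler_wpM2l ?powR_ge0// lerDl.
Qed.
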